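(* Let $\mathcal{M}$ be the set of all symmetric Borel probability measures $\mu$ on $\mathbb{R}$ with finite variance such that $$\ln|X|\le\Gamma(X,\mu)$$ for any non-empty family $X$ of $k$-subsets of $\{1,\ldots,n\}$, any $n\ge 1$, and any $1\le k\le n$. For a measure $\mu\in\mathcal{M}$ and a number $t>0$, let $c(t,\mu)$ be the infimum of $k^{-1}\ln|X|$ taken over all $n\ge1$, all $1\le k\le n$, and all non-empty families $X$ of $k$-subsets of $\{1,\ldots,n\}$ such that $k^{-1}\Gamma(X,\mu)\ge t$. Then for all $\mu\in\mathcal{M}$ and all $t>0$, $$c(t,\mu)\le c(t,\mu_0),$$ where $\mu_0$ is the logistic distribution, i.e. the measure with density $\frac{1}{e^{\gamma}+e^{-\gamma}+2}$, $\gamma\in\mathbb{R}$.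
   Context: A measure $\mu$ on $\mathbb{R}$ is symmetric if $\mu(A)=\mu(-A)$ for all Borel $A\subset\mathbb{R}$. A $k$-subset is a subset with exactly $k$ elements; $|X|$ is the cardinality of $X$. For a symmetric Borel probability measure $\mu$ on $\mathbb{R}$ with finite variance and a non-empty family $X$ of subsets of $\{1,\ldots,n\}$, $$\Gamma(X,\mu)=\mathbf{E}\max_{x\in X}\sum_{i\in x}\gamma_i,$$ where $\gamma_1,\ldots,\gamma_n$ are independent random variables with distribution $\mu$. (The logistic measure $\mu_0$ belongs to $\mathcal{M}$, so $c(t,\mu_0)$ is defined.) *)

(* Defs.v *)
From HB Require Import structures.
From mathcomp Require Import all_boot all_order all_algebra.
From mathcomp Require Import ring lra.
From mathcomp Require Import all_classical all_reals all_analysis measurable_realfun.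

Set Implicit Arguments.
Unset Strict Implicit.
Unset Printing Implicit Defensive.

Import Order.TTheory GRing.Theory Num.Theory.
Import numFieldNormedType.Exports.

Local Open Scope classical_set_scope.
Local Open Scope ring_scope.

Section logistic.
Context {R : realType}.
Notation leb := (@lebesgue_measure R).

Definition logistic_pdf (x : R) : R := (expR x + expR (- x) + 2)^-1.

Lemma logistic_pdf_ge0 x : 0 <= logistic_pdf x.
Proof. by rewrite invr_ge0 !addr_ge0 ?expR_ge0. Qed.

Let den_neq0 x : expR x + expR (- x) + 2 != 0 :> R.
Proof. by rewrite gt_eqF// addr_gt0// addr_gt0 ?expR_gt0. Qed.

Lemma continuous_logistic_pdf : continuous logistic_pdf.
Proof.
move=> x; apply: cvgV; first exact: den_neq0.
apply: cvgD; last exact: cvg_cst.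
apply: cvgD; first exact: continuous_expR.
by apply: continuous_comp; [exact: continuousN|exact: continuous_expR].
Qed.

Lemma measurable_logistic_pdf : measurable_fun [set: R] logistic_pdf.
Proof. exact: continuous_measurable_fun continuous_logistic_pdf. Qed.

Let F (x : R) := - (1 + expR x)^-1.

Let is_derive_F (x : R) : is_derive x (1 : R) F (logistic_pdf x).
Proof.
have E : 1 + expR x != 0 :> R by rewrite gt_eqF// ltr_pwDl// expR_ge0.
have E0 : expR x != 0 :> R by rewrite gt_eqF// expR_gt0.
apply: is_derive_eq.
rewrite /GRing.scale /= add0r /logistic_pdf expRN.
have -> : expR x + (expR x)^-1 + 2 = (1 + expR x) ^+ 2 / expR x by field.
by field; rewrite E E0.
Qed.

Lemma integral_logistic_pdf : (\int[leb]_x (logistic_pdf x)%:E = 1)%E.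
Proof.
rewrite ge0_symfun_integralT//=; first last.
- by move=> x; rewrite /logistic_pdf /= opprK (addrC (expR (- x))).
- exact: continuous_logistic_pdf.
- exact: logistic_pdf_ge0.
have cF : continuous F.
  by move=> x; apply/differentiable_continuous/derivable1_diffP; exact: ex_derive.
rewrite -set_itvcy (@ge0_continuous_FTC2y _ _ F 0 0)//=.
- rewrite /F expR0.
  by congr EFin; field.
- by move=> x _; exact: logistic_pdf_ge0.
- exact/continuous_subspaceT/continuous_logistic_pdf.
- rewrite /F -[X in _ --> X]oppr0; apply: cvgN.
  apply/gtr0_cvgV0; first by near=> x; rewrite ltr_pwDl// expR_ge0.
  apply/cvgryPge => A; near=> x.
  have Ax : A <= x by near: x; apply: nbhs_pinfty_ge; exact: num_real.
  by have := expR_ge1Dx x; lra.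
- by apply/cvg_at_right_filter; exact: cF.
- by move=> x _; rewrite derive1E; exact: (@derive_val _ _ _ _ _ _ _ (is_derive_F x)).
Unshelve. all: end_near. Qed.

Definition logistic_prob (A : set (measurableTypeR R)) : \bar R :=
  (\int[leb]_(x in A) (logistic_pdf x)%:E)%E.

Let logistic0 : logistic_prob set0 = 0%E.
Proof. exact: integral_set0. Qed.

Let logistic_ge0 A : (0 <= logistic_prob A)%E.
Proof. by apply: integral_ge0 => x _; rewrite lee_fin logistic_pdf_ge0. Qed.

Let logistic_sigma_additive : semi_sigma_additive logistic_prob.
Proof.
move=> /= A mA tA mUA; rewrite /logistic_prob; apply: cvg_toP.
  apply: ereal_nondecreasing_is_cvgn => m n mn.
  apply: lee_sum_nneg_natr => // k _ _; apply: integral_ge0 => x _.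
  by rewrite lee_fin logistic_pdf_ge0.
rewrite ge0_integral_bigcup//=.
- by apply/measurable_funTS/measurableT_comp => //; exact: measurable_logistic_pdf.
- by move=> x _; rewrite lee_fin logistic_pdf_ge0.
Qed.

HB.instance Definition _ := isMeasure.Build _ _ _
  logistic_prob logistic0 logistic_ge0 logistic_sigma_additive.

Let logistic_setT : logistic_prob [set: R] = 1%E.
Proof. exact: integral_logistic_pdf. Qed.

HB.instance Definition _ :=
  @Measure_isProbability.Build _ _ R logistic_prob logistic_setT.

End logistic.

Section iid.
Context {R : realType}.
Notation mR := (measurableTypeR R).

Definition cons_pair n (z : mR * n.-tuple mR) : n.+1.-tuple mR :=
  [tuple of z.1 :: z.2].

Lemma measurable_cons_pair n : measurable_fun setT (@cons_pair n).
Proof. exact: (measurable_cons measurable_fst measurable_snd). Qed.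

HB.instance Definition _ n :=
  isMeasurableFun.Build _ _ _ _ (@cons_pair n) (@measurable_cons_pair n).

(* The law of (gamma_1, ..., gamma_n) for independent gamma_i of law mu, i.e.,
   the n-fold product of mu; lemma iid_probE below. *)
Fixpoint iid_prob (mu : probability mR R) n : probability (n.-tuple mR) R :=
  match n with
  | 0 => \d_([tuple])
  | n'.+1 => distribution (mu \x iid_prob mu n')%E (@cons_pair n')
  end.

Lemma iid_probE (mu : probability mR R) n (A : 'I_n -> set mR) :
  (forall i, measurable (A i)) ->
  iid_prob mu n [set w | forall i, A i (tnth w i)] = (\prod_(i < n) mu (A i))%E.
Proof.
elim: n A => [|n IH] A mA /=.
  by rewrite big_ord0 diracE mem_set//; case.
rewrite big_ord_recl -IH//.
rewrite -product_measure1E//; last first.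
  rewrite [X in measurable X](_ : _ =
    \bigcap_(i in [set: 'I_n]) ((fun w => tnth w i) @^-1` A (lift ord0 i))).
    apply: fin_bigcap_measurable => // i _.
    by rewrite -[X in measurable X]setTI; exact: measurable_tnth.
  by apply/seteqP; split => [w Aw i _|w Aw i]; exact: Aw.
rewrite /distribution /pushforward/=; congr product_measure1.
apply/seteqP; split=> [[x w] /= H|[x w] /= [H0 H1] i].
  by split=> [|i]; [exact: (H ord0)|have := H (lift ord0 i); rewrite tnthS].
by have [j ->|->//] := unliftP ord0 i; rewrite tnthS.
Qed.

End iid.

Section Gamma.
Context {R : realType}.
Notation mR := (measurableTypeR R).
Implicit Types mu : probability mR R.

(* The maximum is taken in \bar R, with the neutral value -oo, because the sums
   may be negative; for X nonempty it is finite. *)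
Definition Gamma n (X : {set {set 'I_n}}) mu : \bar R :=
  'E_(iid_prob mu n)[fun w =>
    fine (\big[maxe/-oo%E]_(x in X) (\sum_(i in x) tnth w i)%:E)].

Definition symmetric_measure mu :=
  forall A : set mR, measurable A -> mu A = mu [set - x | x in A].

Definition finite_variance mu := ('V_mu[idfun : mR -> R] < +oo)%E.

Definition ksubset_family n k (X : {set {set 'I_n}}) : Prop :=
  X != finset.set0 /\ {in X, forall x : {set 'I_n}, #|x| = k}.

Definition calM : set (probability mR R) :=
  [set mu | [/\ symmetric_measure mu, finite_variance mu &
    forall n k (X : {set {set 'I_n}}),
      (1 <= n)%N -> (1 <= k <= n)%N -> ksubset_family k X ->
      ((ln #|X|%:R)%:E <= Gamma X mu)%E]].

(* The infimum is taken in \bar R, so it needs no side condition; it is +oo over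
   an empty set of values. *)
Definition c_inf (t : R) mu : \bar R :=
  ereal_inf [set z | exists n k (X : {set {set 'I_n}}),
    [/\ (1 <= n)%N, (1 <= k <= n)%N, ksubset_family k X,
        (t%:E <= k%:R^-1%:E * Gamma X mu)%E &
        z = (k%:R^-1 * ln #|X|%:R)%:E]].

End Gamma.

(* Main.v *)
Require Import Defs.
From HB Require Import structures.
From mathcomp Require Import all_boot all_order all_algebra.
From mathcomp Require Import ring lra.
From mathcomp Require Import all_classical all_reals all_analysis measurable_realfun.

Import Order.TTheory GRing.Theory Num.Theory.
Import numFieldNormedType.Exports.

Local Open Scope classical_set_scope.
Local Open Scope ring_scope.

(** The logistic law is the least element of M for the convex order, and Gamma
is monotone for that order; the inequality between the infima is then an
inclusion between the sets of families over which they are taken.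

Two laws with finite means are compared through their stop-loss functions
s |-> E max(0, gamma - s). For the logistic law this function is
ln (1 + exp (- s)) (logistic_stop_loss). Every mu in M has a stop-loss function
at least as large (stop_loss_lb). To see it, take X to be all k-subsets of
{1, ..., n}: since the sum of gamma_i over a k-subset is at most
s k + sum_i max(0, gamma_i - s), with the last sum over all n indices, the
defining inequality of M gives
  ln binomial(n, k) <= s k + n A,   where A = E max(0, gamma - s).
Multiplying binomial(n, k) <= exp(s k + n A) by exp(- s k) and summing over k
yields (1 + exp (- s)) ^ n <= (n + 1) exp(A) ^ n for all n, which forces
1 + exp (- s) <= exp A. The means are compared as well: the logistic mean is
at most 0 (logistic_mean_le0), and that of mu is at least 0 (mean_ge0, from the
family whose only member is the full subset of {1}).

For fixed values of the other coordinates, max_(x in X) sum_(i in x) gamma_i is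
a function of gamma_j of the form max(a, gamma_j + b), where a or b may be
-oo; its expectation is an affine function of the stop-loss function at a - b,
or the mean plus b, or a constant. So replacing the logistic coordinates by
coordinates of law mu, one at a time, increases the expectation
(le_integral_iid), hence Gamma X mu_0 <= Gamma X mu for every nonempty X. *)

(** * The stop-loss function of the logistic law *)

Section logistic_integrals.
Context {R : realType}.
Notation mR := (measurableTypeR R).
Notation leb := (@lebesgue_measure R).
Notation mu0 := (@logistic_prob R).

Lemma ge0_integral_logistic (f : R -> \bar R) :
  measurable_fun [set: R] f -> (forall x, 0 <= f x)%E ->
  (\int[mu0]_x f x = \int[leb]_x (f x * (logistic_pdf x)%:E))%E.
Proof.
move=> mf f0.
have mp : measurable_fun setT (EFin \o @logistic_pdf R).
  by apply/measurable_EFinP; exact: measurable_logistic_pdf.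
have dom : mu0 `<< leb.
  apply/null_content_dominatesP => A mA A0.
  by apply: null_set_integral => //; exact: measurable_funTS.
rewrite -(Radon_Nikodym_SigmaFinite.change_of_variables dom)//.
have ip : leb.-integrable setT (EFin \o @logistic_pdf R).
  apply/integrableP; split=> //.
  under eq_integral => x _ do
    rewrite gee0_abs ?lee_fin ?logistic_pdf_ge0//.
  by rewrite integral_logistic_pdf ltry.
have iRN := Radon_Nikodym_SigmaFinite.f_integrable dom.
apply: ae_eq_integral => //.
- by apply: emeasurable_funM => //; exact: measurable_int iRN.
- exact: emeasurable_funM.
- apply: ae_eqe_mul2l; apply: integral_ae_eq => // A _ mA.
  by rewrite -Radon_Nikodym_SigmaFinite.f_integral.
Qed.


(** The logistic density is minus the derivative of 1 / (1 + exp y), which is in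
turn minus the derivative of ln (1 + exp (- y)); integrating (y - s) times the
density by parts gives this antiderivative. *)
Let is_derive_tail (s x : R) :
  is_derive x (1 : R)
    (fun y => - ((y - s) / (1 + expR y)) - ln (1 + expR (- y)))
    ((x - s) * logistic_pdf x).
Proof.
have E0 : 0 < expR x by exact: expR_gt0.
have N0 : 0 < expR (- x) by exact: expR_gt0.
have E1 : 1 + expR x != 0 by rewrite gt_eqF// ltr_pwDl// ltW.
have dln : is_derive (1 + expR (- x)) (1 : R) (@ln R) (1 + expR (- x))^-1.
  by apply: is_derive1_ln; rewrite ltr_pwDl// ltW.
have dc : is_derive x (1 : R) (@ln R \o (fun y => 1 + expR (- y)))
    ((1 + expR (- x))^-1 * - expR (- x)).
  apply: is_derive1_comp; apply: is_derive_eq.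
  by rewrite /GRing.scale /= add0r; ring.
apply: is_derive_eq.
rewrite /GRing.scale /= /logistic_pdf expRN.
have E0' : expR x != 0 by rewrite gt_eqF.
have -> : expR x + (expR x)^-1 + 2 = (1 + expR x) ^+ 2 / expR x by field.
have -> : 1 + (expR x)^-1 = (1 + expR x) / expR x by field.
by field; rewrite E0' E1.
Qed.

(** For y >= max(1, s), both terms are O(1 / y): exp y is at least
y ^ 2 / 4 and at least y. *)
Let tail_cvg0 (s : R) :
  (- ((y - s) / (1 + expR y)) - ln (1 + expR (- y))) @[y --> +oo] --> (0 : R).
Proof.
rewrite -[X in _ --> X]oppr0.
under eq_cvg => y do rewrite -opprD.
apply: cvgN.
have cB : ((4 * (1 + `|s|) + 1) / y) @[y --> +oo] --> (0 : R).
  rewrite -[X in _ --> X](mulr0 (4 * (1 + `|s|) + 1)).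
  apply: cvgM; first exact: cvg_cst.
  apply/gtr0_cvgV0; last exact: cvg_id.
  exact: nbhs_pinfty_gt.
apply: (squeeze_cvgr _ (cvg_cst 0) cB).
near=> y.
have y1 : 1 <= y by near: y; apply: nbhs_pinfty_ge; exact: num_real.
have ys : s <= y by near: y; apply: nbhs_pinfty_ge; exact: num_real.
have y0 : 0 < y by lra.
have Ey : y ^+ 2 / 4 <= expR y.
  rewrite [X in expR X](_ : y = y / 2 + y / 2); last by lra.
  rewrite expRD; have := expR_ge1Dx (y / 2) => h.
  have : (1 + y / 2) * (1 + y / 2) <= expR (y / 2) * expR (y / 2).
    by apply: ler_pM => //; lra.
  by nra.
have Ey0 : 0 < expR y by exact: expR_gt0.
have N0 : 0 < expR (- y) by exact: expR_gt0.
have l0 : 0 <= ln (1 + expR (- y)) by apply: ln_ge0; lra.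
have l1 : ln (1 + expR (- y)) <= y^-1.
  apply: (@le_trans _ _ (expR (- y))).
    by have := @le_ln1Dx R (expR (- y)); apply; lra.
  rewrite expRN lef_pV2 ?posrE//.
  by have := expR_ge1Dx y; lra.
have f0 : 0 <= (y - s) / (1 + expR y) by apply: divr_ge0; lra.
have f1 : (y - s) / (1 + expR y) <= 4 * (1 + `|s|) / y.
  rewrite ler_pdivrMr; last by lra.
  rewrite mulrAC ler_pdivlMr//.
  have : - s <= `|s| by have := ler_norm (- s); rewrite normrN.
  have : 0 <= `|s| by [].
  move: `|s| => a a0 sa.
  have : 0 <= (s + a) * y by apply: mulr_ge0; lra.
  have : 0 <= a * (y * (y - 1)) by rewrite !mulr_ge0//; lra.
  have : (1 + a) * y ^+ 2 <= (1 + a) * (4 * expR y).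
    by apply: ler_wpM2l; lra.
  by move: y1 y0; rewrite expr2; lra.
rewrite /= addr_ge0//= [leRHS]mulrDl mul1r.
exact: lerD.
Unshelve. all: end_near. Qed.

Lemma logistic_tail (s : R) :
  (\int[leb]_(x in `[s, +oo[) ((x - s) * logistic_pdf x)%:E
   = (ln (1 + expR (- s)))%:E)%E.
Proof.
have cT : continuous
    (fun y => - ((y - s) / (1 + expR y)) - ln (1 + expR (- y))).
  move=> x; apply/differentiable_continuous/derivable1_diffP.
  exact: (@ex_derive _ _ _ _ _ _ _ (is_derive_tail s x)).
rewrite (@ge0_continuous_FTC2y _ _
    (fun y => - ((y - s) / (1 + expR y)) - ln (1 + expR (- y))) s 0) //=.
- by rewrite subrr mul0r oppr0 sub0r -EFinB sub0r opprK.
- by move=> x sx; rewrite mulr_ge0 ?logistic_pdf_ge0// subr_ge0.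
- apply: continuous_subspaceT => x.
  apply: cvgM; last exact: continuous_logistic_pdf.
  by apply: cvgB; [exact: cvg_id|exact: cvg_cst].
- by move=> x _; exact: (@ex_derive _ _ _ _ _ _ _ (is_derive_tail s x)).
- by apply/cvg_at_right_filter; exact: cT.
- move=> x _; rewrite derive1E.
  exact: (@derive_val _ _ _ _ _ _ _ (is_derive_tail s x)).
Qed.

Lemma logistic_stop_loss (s : R) :
  (\int[mu0]_x (Num.max 0 (x - s))%:E = (ln (1 + expR (- s)))%:E)%E.
Proof.
rewrite ge0_integral_logistic; last 2 first.
- apply/measurable_EFinP/measurable_maxr => //.
  by apply: measurable_funB.
- by move=> x; rewrite lee_fin le_max lexx.
rewrite -logistic_tail integral_mkcond [RHS]integral_mkcond/=.
rewrite [LHS]integral_mkcond [RHS]integral_mkcond/=.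
apply: eq_integral => x _; rewrite !patchE !in_setT.
case: ifPn => [|].
  rewrite inE/= in_itv/= andbT => sx.
  by rewrite -EFinM max_r// subr_ge0.
rewrite notin_setE/= in_itv/= andbT => /negP; rewrite -ltNge => xs.
by rewrite max_l ?mul0e// subr_le0 ltW.
Qed.

(** By symmetry of the density, E |gamma| is twice the tail integral at 0. *)
Lemma integrable_logistic_id : mu0.-integrable setT (fun x : R => x%:E).
Proof.
apply/integrableP; split; first exact/measurable_EFinP.
rewrite ge0_integral_logistic; last 2 first.
- exact/measurableT_comp/measurable_EFinP.
- by move=> x; exact: abse_ge0.
under eq_integral => x _ do rewrite /= -EFinM.
rewrite ge0_symfun_integralT.
- rewrite -set_itvcy.
  rewrite [X in (_ * X)%E](_ : _ = (ln (1 + expR (- 0)))%:E) ?ltry//.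
  rewrite -logistic_tail; apply: eq_integral => x.
  by rewrite inE/= in_itv/= andbT subr0 => x0; rewrite ger0_norm.
- by move=> x; rewrite mulr_ge0 ?logistic_pdf_ge0.
- move=> x; apply: cvgM; last exact: continuous_logistic_pdf.
  exact: norm_continuous.
- by move=> x /=; rewrite normrN /logistic_pdf opprK (addrC (expR (- x))).
Qed.

End logistic_integrals.

(** * Coordinates of an i.i.d. tuple *)

Lemma integral_prob_cst d (T : measurableType d) (R : realType)
    (P : probability T R) (k : \bar R) : (\int[P]_x k = k)%E.
Proof.
have := integral_cst P measurableT k.
by rewrite [X in (_ * X)%E]probability_setT mule1.
Qed.

Section marginals.
Context {R : realType}.
Notation mR := (measurableTypeR R).
Implicit Types m : probability mR R.

Lemma iid_prob_marginal m n (i : 'I_n) (A : set R) : measurable A ->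
  iid_prob m n ((fun w => tnth w i) @^-1` A) = m A.
Proof.
move=> mA.
pose B (j : 'I_n) : set mR := if j == i then A else setT.
have mB j : measurable (B j) by rewrite /B; case: ifP.
rewrite [X in iid_prob m n X](_ : _ = [set w | forall j, B j (tnth w j)]).
  rewrite iid_probE// (bigD1 i)//= big1 ?mule1 /B ?eqxx// => j /negbTE ->.
  exact: probability_setT.
apply/seteqP; split=> [w /= Aw j|w /= /(_ i)]; rewrite /B ?eqxx//.
by case: eqP => [->|].
Qed.

Lemma ge0_integral_tnth m n (i : 'I_n) (f : R -> \bar R) :
  measurable_fun [set: R] f -> (forall x, 0 <= f x)%E ->
  (\int[iid_prob m n]_w f (tnth w i) = \int[m]_x f x)%E.
Proof.
move=> mf f0.
have mt : measurable_fun setT (fun w : n.-tuple mR => tnth w i).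
  exact: measurable_tnth.
have -> : (\int[iid_prob m n]_w f (tnth w i) =
    \int[pushforward (iid_prob m n) (fun w => tnth w i)]_x f x)%E.
  by rewrite ge0_integral_pushforward.
by apply: eq_measure_integral => A mA _; exact: iid_prob_marginal.
Qed.

Lemma integrable_tnth m n (i : 'I_n) :
  m.-integrable setT (fun x : R => x%:E) ->
  (iid_prob m n).-integrable setT (fun w => (tnth w i)%:E).
Proof.
move=> /integrableP[_ mi]; apply/integrableP; split.
  by apply/measurable_EFinP; exact: measurable_tnth.
have := @ge0_integral_tnth m n i (fun x => `|x%:E|%E) => ->//.
exact/measurableT_comp/measurable_EFinP.
Qed.

Lemma integral_tnth m n (i : 'I_n) :
  m.-integrable setT (fun x : R => x%:E) ->
  (\int[iid_prob m n]_w (tnth w i)%:E = \int[m]_x x%:E)%E.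
Proof.
move=> im; have it := integrable_tnth m n i im.
have mt : measurable_fun setT (fun w : n.-tuple mR => tnth w i).
  exact: measurable_tnth.
transitivity (\int[pushforward (iid_prob m n) (fun w => tnth w i)]_x x%:E)%E.
  by rewrite integral_pushforward//; exact/measurable_EFinP.
by apply: eq_measure_integral => A mA _; exact: iid_prob_marginal.
Qed.

(** The head and the tail of the tuple may have different laws: the hybrids of
the coordinate-by-coordinate replacement are of this kind. *)
Lemma integrable_cons_pair m1 m2 n (i : 'I_n.+1) :
  m1.-integrable setT (fun x : R => x%:E) ->
  m2.-integrable setT (fun x : R => x%:E) ->
  (m1 \x iid_prob m2 n)%E.-integrable setT
    (fun z => (tnth (cons_pair z) i)%:E).
Proof.
move=> i1 i2.
have mz : measurable_fun setT (fun z : mR * n.-tuple mR =>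
    (tnth (cons_pair z) i)%:E).
  apply/measurable_EFinP.
  apply: (measurableT_comp (measurable_tnth i)).
  exact: measurable_cons_pair.
apply/integrable12ltyP => //.
have [j ->|->] := unliftP ord0 i.
- under eq_integral => x _ do under eq_integral => w _ do rewrite /= tnthS /=.
  rewrite integral_prob_cst.
  by have /integrableP[] := @integrable_tnth m2 n j i2.
- rewrite [ltLHS](_ : _ = (\int[m1]_x `|x%:E|)%E).
    by have /integrableP[] := i1.
  apply: eq_integral => x _.
  rewrite -[RHS](integral_prob_cst _ _ _ (iid_prob m2 n)).
  exact: eq_integral.
Qed.

End marginals.

(** * Maxima of sums of coordinates *)

Section max_affine.
Context {R : realType}.
Notation mR := (measurableTypeR R).

(** The additive constant makes the class stable under fixing some of the
coordinates, which the induction on the number of coordinates needs. *)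
Inductive max_affine n : (n.-tuple R -> R) -> Prop :=
| MaxAffineSum (c : R) (b : 'I_n -> bool) :
    max_affine n (fun w => c + \sum_(i | b i) tnth w i)
| MaxAffineMax f g : max_affine n f -> max_affine n g ->
    max_affine n (fun w => Num.max (f w) (g w)).

Lemma max_affine_integrable d (T : measurableType d) (P : probability T R)
    n (X : T -> n.-tuple R) (f : n.-tuple R -> R) :
  (forall i, P.-integrable setT (fun t => (tnth (X t) i)%:E)) ->
  max_affine n f -> P.-integrable setT (fun t => (f (X t))%:E).
Proof.
move=> iX; elim=> {f} [c b|f g _ If _ Ig].
  under eq_fun do rewrite EFinD -sumEFin.
  apply: integrableD => //; first exact: finite_measure_integrable_cst.
  by apply: integrable_sum => // i _; exact: iX.
apply: (@le_integrable _ _ _ _ _ _ _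
    (fun t => `|(f (X t))%:E| + `|(g (X t))%:E|)%E) => //.
- apply/measurable_EFinP/measurable_maxr; apply/measurable_EFinP.
    exact: measurable_int If.
  exact: measurable_int Ig.
- move=> t _; rewrite -EFinD /= lee_fin [leRHS]ger0_norm ?addr_ge0//.
  by rewrite /Num.max; case: ifP => _; rewrite ?lerDr ?lerDl.
- by apply: integrableD => //; exact: integrable_abse.
Qed.

Lemma max_affine_cons n (f : n.+1.-tuple R -> R) (x : R) :
  max_affine n.+1 f -> max_affine n (fun w => f [tuple of x :: w]).
Proof.
elim=> {f} [c b|f g _ ? _ ?]; last exact: MaxAffineMax.
have -> : (fun w : n.-tuple R =>
      c + \sum_(i | b i) tnth [tuple of x :: w] i) =
    (fun w => (c + if b ord0 then x else 0) +
      \sum_(i | (b \o lift ord0) i) tnth w i).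
  apply/funext => w; rewrite -addrA; congr (_ + _).
  rewrite big_mkcond big_ord_recl [in RHS]big_mkcond/=; congr (_ + _).
  by apply: eq_bigr => i _; rewrite tnthS.
exact: (MaxAffineSum _ _ (b \o lift ord0)).
Qed.

(** A maximum of affine functions of slope 0 or 1 has at most one kink. Allowing
-oo for a and b covers the functions of constant slope, and lets the property
pass to maxima without case analysis. *)
Lemma max_affine_coord n (f : n.+1.-tuple R -> R) (w : n.-tuple R) :
  max_affine n.+1 f ->
  exists a b : \bar R, forall x : R,
    (f [tuple of x :: w])%:E = maxe a (x%:E + b)%E.
Proof.
elim=> {f} [c B|f g _ [a [b fE]] _ [a' [b' gE]]].
  pose v := c + \sum_(i | B (lift ord0 i)) tnth w i.
  have E x : c + \sum_(i | B i) tnth [tuple of x :: w] i =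
      (if B ord0 then x else 0) + v.
    rewrite big_mkcond big_ord_recl/= addrCA; congr (_ + (_ + _)).
    by rewrite [in RHS]big_mkcond/=; apply: eq_bigr => i _; rewrite tnthS.
  case: (B ord0) E => E.
    by exists -oo%E, v%:E => x; rewrite E maxNye.
  by exists v%:E, -oo%E => x; rewrite E add0r addeNy maxeNy.
exists (maxe a a'), (maxe b b') => x.
rewrite EFin_max fE gE maxACA; congr (maxe _ _).
by apply/esym; exact: adde_maxr.
Qed.

End max_affine.

(** * Monotonicity for the convex order *)

Lemma integrable_integral_fst d1 d2 (T1 : measurableType d1)
    (T2 : measurableType d2) (R : realType) (m1 : probability T1 R)
    (m2 : probability T2 R) (f : T1 * T2 -> \bar R) :
  (m1 \x m2)%E.-integrable setT f ->
  m2.-integrable setT (fun y => (\int[m1]_x f (x, y))%E).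
Proof.
move=> fi; have mf := measurable_int _ fi.
have fsi : (m2 \x m1)%E.-integrable setT (fun z => f (z.2, z.1)).
  apply/integrable12ltyP; first exact/(measurableT_comp mf)/measurable_fun_pair.
  exact/(integrable21ltyP m1 m2 mf).
exact: (integrable_fubini_F fsi).
Qed.

Section comparison.
Context {R : realType}.
Notation mR := (measurableTypeR R).
Implicit Types m : probability mR R.

Lemma integrable_stop_loss d (T : measurableType d) (P : probability T R)
    (Y : T -> R) (s : R) :
  P.-integrable setT (fun t => (Y t)%:E) ->
  P.-integrable setT (fun t => (Num.max 0 (Y t - s))%:E).
Proof.
move=> iY.
apply: (@le_integrable _ _ _ _ _ _ _ (fun t => (Y t)%:E - s%:E)%E) => //.
- apply/measurable_EFinP/measurable_maxr => //.
  apply: measurable_funB => //; apply/measurable_EFinP.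
  exact: measurable_int iY.
- move=> t _; rewrite -EFinB !abse_EFin lee_fin.
  by rewrite /Num.max; case: ifP => // _; rewrite normr0.
- by apply: integrableB => //; exact: finite_measure_integrable_cst.
Qed.

Section two_laws.
Variables m0 m : probability mR R.
Hypothesis i0 : m0.-integrable setT (fun x : R => x%:E).
Hypothesis i1 : m.-integrable setT (fun x : R => x%:E).
Hypothesis mean_le : (\int[m0]_x x%:E <= \int[m]_x x%:E)%E.
Hypothesis stop_loss_le : forall s : R,
  (\int[m0]_x (Num.max 0 (x - s))%:E <= \int[m]_x (Num.max 0 (x - s))%:E)%E.

(** With a and b finite, max(a, x + b) = a + max(0, x - (a - b)), so the
stop-loss inequality applies; slope 1 needs the inequality of the means. *)
Lemma le_integral_coord n (f : n.+1.-tuple R -> R) (w : n.-tuple R) :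
  max_affine n.+1 f ->
  (\int[m0]_x (f [tuple of x :: w])%:E <= \int[m]_x (f [tuple of x :: w])%:E)%E.
Proof.
move=> /(max_affine_coord _ _ w)[a [b fE]].
under eq_integral => x _ do rewrite fE.
under [leRHS]eq_integral => x _ do rewrite fE.
(* The value at 0 excludes +oo, and -oo for both a and b. *)
case: a fE => [a||] fE; case: b fE => [b||] fE;
  try by have := fE 0; rewrite add0e ?maxey.
- have E x : maxe a%:E (x%:E + b%:E) =
      (a%:E + (Num.max 0 (x - (a - b)))%:E)%E.
    rewrite -!EFinD -EFin_max; congr EFin.
    by rewrite addr_maxr addr0; congr Num.max; ring.
  under eq_integral => x _ do rewrite E.
  under [leRHS]eq_integral => x _ do rewrite E.
  rewrite !integralD//; try exact: finite_measure_integrable_cst;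
    try exact: integrable_stop_loss.
  by rewrite !integral_prob_cst leeD2l.
- under eq_integral => x _ do rewrite addeNy maxeNy.
  under [leRHS]eq_integral => x _ do rewrite addeNy maxeNy.
  by rewrite !integral_prob_cst.
- under eq_integral => x _ do rewrite maxNye.
  under [leRHS]eq_integral => x _ do rewrite maxNye.
  rewrite !integralD//; try exact: finite_measure_integrable_cst.
  by rewrite !integral_prob_cst leeD2r.
Qed.

(** The hybrid product m0 x m^n separates the two replacements: the tail of the
tuple is changed by induction after integrating it first, and then the head by
le_integral_coord after exchanging the integrals. *)
Lemma le_integral_iid n (f : n.-tuple R -> R) : max_affine n f ->
  (\int[iid_prob m0 n]_w (f w)%:E <= \int[iid_prob m n]_w (f w)%:E)%E.
Proof.
elim: n f => [//|n IH] f fa.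
have mf : measurable_fun setT (EFin \o f : n.+1.-tuple mR -> \bar R).
  apply: (measurable_int (iid_prob m n.+1)).
  apply: max_affine_integrable fa => i; exact: integrable_tnth.
have ip (p q : probability mR R) :
    p.-integrable setT (fun x : R => x%:E) ->
    q.-integrable setT (fun x : R => x%:E) ->
    (p \x iid_prob q n)%E.-integrable setT (fun z => (f (cons_pair z))%:E).
  move=> ip iq.
  apply: (max_affine_integrable _ _ (p \x iid_prob q n)%E _
    (@cons_pair R n) f _ fa).
  by move=> i; exact: integrable_cons_pair.
have iidE (q : probability mR R) : q.-integrable setT (fun x : R => x%:E) ->
    (\int[iid_prob q n.+1]_w (f w)%:E =
     \int[q \x iid_prob q n]_z (f (cons_pair z))%:E)%E.
  by move=> iq; rewrite integral_distribution//; exact: ip.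
rewrite !iidE//.
apply: (@le_trans _ _ (\int[m0 \x iid_prob m n]_z (f (cons_pair z))%:E)%E).
  rewrite -!integral12_prod_meas1; try exact: ip.
  apply: le_integral => //; try by apply: integrable_fubini_F; exact: ip.
  move=> x _; apply: (IH (fun w => f [tuple of x :: w])).
  exact: max_affine_cons.
rewrite -!integral21_prod_meas1; try exact: ip.
apply: le_integral => //; try by apply: integrable_integral_fst; exact: ip.
by move=> w _; exact: le_integral_coord.
Qed.

End two_laws.
End comparison.

(** * Gamma and the measures in M *)

Section gamma.
Context {R : realType}.
Notation mR := (measurableTypeR R).
Implicit Types m : probability mR R.

(** The sums may be negative, so the neutral value -oo of the maximum is removed
only once the family is known to be nonempty. *)
Lemma bigmax_max_affine n (X : {set {set 'I_n}}) : X != finset.set0 ->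
  exists2 f : n.-tuple R -> R, max_affine n f &
    forall w, (\big[maxe/-oo]_(x in X) (\sum_(i in x) tnth w i)%:E =
               (f w)%:E)%E.
Proof.
rewrite -card_gt0 cardE => X0.
suff [f fa fE] : exists2 f : n.-tuple R -> R, max_affine n f &
    forall w, (\big[maxe/-oo]_(x <- enum X) (\sum_(i in x) tnth w i)%:E =
               (f w)%:E)%E.
  by exists f => // w; rewrite -fE big_enum.
elim: (enum X) X0 => // x [|y s] IH _.
  exists (fun w => 0 + \sum_(i in x) tnth w i).
    exact: (MaxAffineSum _ _ (mem x)).
  by move=> w; rewrite big_seq1 add0r.
have [f fa fE] := IH isT.
exists (fun w => Num.max (0 + \sum_(i in x) tnth w i) (f w)).
  by apply: MaxAffineMax => //; exact: (MaxAffineSum _ _ (mem x)).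
by move=> w; rewrite big_cons fE add0r EFin_max.
Qed.

Lemma GammaE n (X : {set {set 'I_n}}) : X != finset.set0 ->
  exists f : n.-tuple R -> R, [/\ max_affine n f,
    forall m, Gamma X m = (\int[iid_prob m n]_w (f w)%:E)%E &
    forall w, (\big[maxe/-oo]_(x in X) (\sum_(i in x) tnth w i)%:E =
               (f w)%:E)%E].
Proof.
move=> /bigmax_max_affine[f fa fE]; exists f; split=> // m.
by rewrite /Gamma unlock; apply: eq_integral => w _; rewrite fE.
Qed.

(** For any x in X, the sum over x of gamma_i = s + (gamma_i - s) is at most
s k + sum_i max(0, gamma_i - s), a bound that no longer depends on x. *)
Lemma Gamma_le m n k (X : {set {set 'I_n}}) (s : R) :
  m.-integrable setT (fun x : R => x%:E) -> ksubset_family k X ->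
  (Gamma X m <= (s * k%:R)%:E +
     n%:R%:E * \int[m]_x (Num.max 0 (x - s))%:E)%E.
Proof.
move=> im [X0 Xk]; have [f [fa -> fE]] := GammaE _ _ X0.
have it i : (iid_prob m n).-integrable setT (fun w => (tnth w i)%:E).
  exact: integrable_tnth.
have isl i : (iid_prob m n).-integrable setT
    (fun w => (Num.max 0 (tnth w i - s))%:E) by exact: integrable_stop_loss.
have -> : (n%:R%:E * \int[m]_x (Num.max 0 (x - s))%:E =
    \sum_(i < n) \int[iid_prob m n]_w (Num.max 0 (tnth w i - s))%:E)%E.
  under eq_bigr => i _.
    rewrite (ge0_integral_tnth m n i (fun x => (Num.max 0 (x - s))%:E)).
    - over.
    - apply/measurable_EFinP/measurable_maxr => //.
      exact: measurable_funB.
    - by move=> x; rewrite lee_fin le_max lexx.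
  have Jfin :=
    integrable_fin_num measurableT (integrable_stop_loss _ _ m _ s im).
  by rewrite -(fineK Jfin) sumEFin sumr_const card_ord -EFinM mulr_natl.
rewrite -integral_sum//.
rewrite -[X in (X + _)%E](integral_prob_cst _ _ _ (iid_prob m n)).
rewrite -integralD//; last 2 first.
- exact: finite_measure_integrable_cst.
- by apply: integrable_sum => // i _; exact: isl.
apply: le_integral => //.
- exact: max_affine_integrable fa.
- apply: integrableD => //; first exact: finite_measure_integrable_cst.
  by apply: integrable_sum => // i _; exact: isl.
move=> w _; rewrite -fE.
elim/big_ind: _ => [|x y|x xX].
- by rewrite leNye.
- by rewrite ge_max => -> ->.
rewrite sumEFin -EFinD lee_fin.
have <- : \sum_(i in x) s = s * k%:R by rewrite sumr_const Xk// mulr_natr.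
apply: (@le_trans _ _ (\sum_(i in x) (s + Num.max 0 (tnth w i - s)))).
  by apply: ler_sum => i _; rewrite -lerBlDl le_max lexx orbT.
rewrite big_split/= lerD2l [leRHS](bigID (mem x))/= lerDl.
by apply: sumr_ge0 => i _; rewrite le_max lexx.
Qed.

(** If r = 1 + h with h > 0, squaring Bernoulli's inequality gives
r ^ (2 n) >= (1 + n h) ^ 2, which exceeds 2 n + 1 as soon as n h ^ 2 > 2. *)
Lemma expr_le_succ_le1 (r : R) : 0 <= r ->
  (forall n, r ^+ n <= n.+1%:R) -> r <= 1.
Proof.
move=> r0 rn; rewrite leNgt; apply/negP => r1.
pose h := r - 1; have h0 : 0 < h by rewrite subr_gt0.
have bern n : 1 + h *+ n <= r ^+ n.
  elim: n => [|n IH]; first by rewrite mulr0n addr0 expr0.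
  rewrite exprS; have -> : r = 1 + h by rewrite /h; ring.
  move: IH; have -> : r = 1 + h by rewrite /h; ring.
  move=> IH; apply: (@le_trans _ _ ((1 + h) * (1 + h *+ n))); last first.
    by apply: ler_wpM2l => //; rewrite addr_ge0 ?ltW.
  have : 0 <= h *+ n by rewrite mulrn_wge0// ltW.
  by rewrite mulrS; move: (h *+ n) => a; nra.
pose n := (Num.bound (2 / h ^+ 2)).+1.
have nb : 2 / h ^+ 2 < n%:R.
  apply: (@lt_trans _ _ (Num.bound (2 / h ^+ 2))%:R); last by rewrite ltr_nat.
  by apply: archi_boundP; rewrite divr_ge0// exprn_ge0// ltW.
have n0 : (0 : R) < n%:R by rewrite ltr0n.
have := rn (n + n)%N; rewrite exprD -natr1 natrD.
have b2 : (1 + h *+ n) * (1 + h *+ n) <= r ^+ n * r ^+ n.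
  by apply: ler_pM => //; rewrite addr_ge0// mulrn_wge0// ltW.
move: b2; rewrite -(mulr_natr h); move: (r ^+ n * r ^+ n) => q.
move: nb; rewrite ltr_pdivrMr ?exprn_gt0//.
move: n%:R n0 => a a0 nb b2 qa.
have : 2 * a < a * h ^+ 2 * a by rewrite ltr_pM2r.
have : 0 < h * a by exact: mulr_gt0.
by rewrite expr2; lra.
Qed.

Definition ln_card_le_Gamma m :=
  forall n k (X : {set {set 'I_n}}),
    (1 <= n)%N -> (1 <= k <= n)%N -> ksubset_family k X ->
    ((ln #|X|%:R)%:E <= Gamma X m)%E.

(** The families of all k-subsets for 0 <= k <= n are tested together: summing
their bounds produces (1 + exp (- s)) ^ n by the binomial formula and costs only
a factor n + 1, which disappears in the n-th root. *)
Lemma stop_loss_lb m (s : R) : m.-integrable setT (fun x : R => x%:E) ->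
  ln_card_le_Gamma m ->
  ((ln (1 + expR (- s)))%:E <= \int[m]_x (Num.max 0 (x - s))%:E)%E.
Proof.
move=> im lnX.
have Afin : (\int[m]_x (Num.max 0 (x - s))%:E)%E \is a fin_num.
  by apply: integrable_fin_num => //; exact: integrable_stop_loss.
rewrite -(fineK Afin) lee_fin.
set A := fine _.
have A0 : 0 <= A.
  by apply/fine_ge0/integral_ge0 => x _; rewrite lee_fin le_max lexx.
have binle n k : (k <= n)%N ->
    expR (- s) ^+ k *+ 'C(n, k) <= expR A ^+ n.
  move=> kn; case: (posnP k) => [->|k0].
    by rewrite bin0 expr0 mulr1n exprn_ege1// -expR0 ler_expR.
  pose X := [set x : {set 'I_n} | #|x| == k]%SET.
  have cX : #|X| = 'C(n, k) by rewrite /X card_draws card_ord.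
  have kX : ksubset_family k X.
    split; last by move=> x; rewrite inE => /eqP.
    by rewrite -card_gt0 cX bin_gt0.
  have := lnX n k X (leq_trans k0 kn).
  rewrite k0 kn => /(_ isT kX) /le_trans/(_ (Gamma_le _ _ _ _ s im kX)).
  rewrite -(fineK Afin) -/A -EFinM -EFinD lee_fin cX => le.
  have C0 : (0 : R) < 'C(n, k)%:R by rewrite ltr0n bin_gt0.
  rewrite -[_ *+ 'C(n, k)]mulr_natl -[X in X * _]lnK// -!expRM_natl -expRD.
  by rewrite ler_expR; move: le; rewrite mulrN; lra.
have N0 : 0 < expR (- s) by exact: expR_gt0.
rewrite -ler_expR lnK ?posrE; last by lra.
rewrite -[leRHS]mul1r -ler_pdivrMr ?expR_gt0//.
apply: expr_le_succ_le1; first by rewrite divr_ge0 ?expR_ge0//; lra.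
move=> n; rewrite expr_div_n ler_pdivrMr ?exprn_gt0 ?expR_gt0//.
rewrite exprDn; apply: (@le_trans _ _ (\sum_(i < n.+1) expR A ^+ n)).
  apply: ler_sum => i _; rewrite expr1n mul1r.
  by apply: binle; rewrite -ltnS.
by rewrite sumr_const card_ord mulr_natl.
Qed.

(** |x| <= |x - c| + |c| <= (x - c) ^ 2 + 1 + |c|, where c is the real number
that centers the variance. *)
Lemma finite_variance_integrable m : finite_variance m ->
  m.-integrable setT (fun x : R => x%:E).
Proof.
rewrite /finite_variance /variance unlock unlock /=.
set c := fine _ => Vfin.
have i2 : m.-integrable setT (fun x : R => ((x - c) * (x - c))%:E).
  apply/integrableP; split.
    by apply/measurable_EFinP/measurable_funM; exact: measurable_funB.
  under eq_integral => x _ do rewrite /= ger0_norm -?expr2 ?sqr_ge0//.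
  exact: Vfin.
apply: (@le_integrable _ mR R m setT measurableT (fun x : R => x%:E)
    (fun x : R => ((x - c) * (x - c))%:E + (1 + `|c|)%:E)%E).
- exact/measurable_EFinP.
- move=> x _; rewrite -EFinD !abse_EFin lee_fin.
  have h : 0 <= (x - c) * (x - c) + (1 + `|c|).
    by rewrite -expr2 !addr_ge0// sqr_ge0.
  rewrite [leRHS]ger0_norm//.
  apply: (@le_trans _ _ (`|x - c| + `|c|)).
    by have := ler_normD (x - c) c; rewrite subrK.
  rewrite addrA lerD2r -expr2 -real_normK ?num_real//.
  by have : 0 <= `|x - c| by []; nra.
- by apply: integrableD => //; exact: finite_measure_integrable_cst.
Qed.

(** E gamma <= E max(0, gamma - s) + s = ln (1 + exp s), which tends to 0 as
s tends to -oo. *)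
Lemma logistic_mean_le0 : (\int[@logistic_prob R]_x x%:E <= 0)%E.
Proof.
have im := @integrable_logistic_id R.
have mean_le s : (\int[@logistic_prob R]_x x%:E <= (ln (1 + expR s))%:E)%E.
  have -> : ln (1 + expR s) = ln (1 + expR (- s)) + s.
    have s0 := expR_gt0 s; have Ns0 := expR_gt0 (- s).
    apply: (@expR_inj R); rewrite expRD !lnK ?posrE; [|lra|lra].
    by rewrite expRN; field; rewrite gt_eqF.
  rewrite EFinD -logistic_stop_loss.
  rewrite -[X in (_ + X)%E](integral_prob_cst _ _ _ (@logistic_prob R)).
  have ic : (@logistic_prob R).-integrable setT (fun=> s%:E).
    exact: finite_measure_integrable_cst.
  have isl := integrable_stop_loss _ _ _ _ s im.
  rewrite -integralD//; apply: le_integral => //.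
    exact: integrableD.
  by move=> x _; rewrite -EFinD lee_fin -lerBlDr le_max lexx orbT.
rewrite leNgt; apply/negP => M0.
have fm := integrable_fin_num measurableT im.
move: M0 mean_le; rewrite -(fineK fm); set M := fine _; rewrite lte_fin => M0.
(* This s satisfies ln (1 + exp s) <= exp s = M / 2 < M. *)
move=> /(_ (ln (M / 2))); rewrite lee_fin lnK ?posrE; last by lra.
by have := @le_ln1Dx R (M / 2); lra.
Qed.

Lemma mean_ge0 m : m.-integrable setT (fun x : R => x%:E) ->
  ln_card_le_Gamma m ->
  (0 <= \int[m]_x x%:E)%E.
Proof.
move=> im lnX.
pose x1 : {set 'I_1} := finset.setTfor 'I_1.
have k1 : ksubset_family 1 [set x1]%SET.
  split; first by rewrite -card_gt0 cards1.
  by move=> x; rewrite !inE => /eqP ->; rewrite cardsT card_ord.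
have := lnX 1%N 1%N _ isT isT k1.
rewrite cards1 ln1 => /le_trans; apply.
rewrite /Gamma unlock /=.
under eq_integral => w _.
  rewrite big_set1/= big_mkcond big_ord1 inE/=.
  over.
by rewrite integral_tnth.
Qed.

Lemma le_Gamma_logistic m n (X : {set {set 'I_n}}) : calM m ->
  X != finset.set0 -> (Gamma X (@logistic_prob R) <= Gamma X m)%E.
Proof.
move=> [_ /finite_variance_integrable im lnX] /GammaE[f [fa GE _]].
rewrite !GE; apply: le_integral_iid => //.
- exact: integrable_logistic_id.
- exact: le_trans logistic_mean_le0 (mean_ge0 _ im lnX).
- by move=> s; rewrite logistic_stop_loss; exact: stop_loss_lb.
Qed.

End gamma.

Theorem theorem3p3 (R : realType) (mu : probability (measurableTypeR R) R)
    (t : R) (mu_in_M : calM mu) (t_gt0 : 0 < t) :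
  (c_inf t mu <= c_inf t (@logistic_prob R))%E.
Proof.
apply: le_ereal_inf => _ [n [k [X [n1 kn Xk tX ->]]]].
exists n, k, X; split=> //; apply: (le_trans tX).
by apply: lee_wpmul2l => //; exact: le_Gamma_logistic mu_in_M Xk.1.
Qed.
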